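(* Let $(X,* )$ be a rack. Then $(X,\{*^i\}_{i\in\mathbb Z})$ is a $\mathbb Z$-family of racks. Furthermore, if $\operatorname{type}X$ is finite, then $(X,\{*^i\}_{i\in\mathbb Z_{\operatorname{type}X}})$ is a $\mathbb Z_{\operatorname{type}X}$-family of racks.
   Context: A rack is a non-empty set $X$ with a binary operation $*:X\times X\to X$ such that for every $a\in X$ the map $S_a:X\to X$, $S_a(x)=x*a$, is a bijection, and $(x*y)*z=(x*z)*(y*z)$ for all $x,y,z\in X$. For $a,x\in X$ and $k\in\mathbb Z$ write $x*^ka:=S_a^k(x)$ (with $S_a^0=\mathrm{id}_X$). The type of a rack $X$, $\operatorname{type}X$, is the minimal positive integer $n$ with $a*^nb=a$ for all $a,b\in X$, and $\operatorname{type}X=\infty$ if no such $n$ exists. $\mathbb Z_n$ denotes the cyclic group $\mathbb Z/n\mathbb Z$; for $i\in\mathbb Z_{\operatorname{type}X}$, $*^i$ means $*^k$ for any integer $k$ representing $i$. For a group $G$ with identity $e$, a $G$-family of racks is a set $X$ with binary operations $*^g:X\times X\to X$ ($g\in G$) such that for all $x,y,z\in X$ and $g,h\in G$: $x*^{gh}y=(x*^gy)*^hy$, $x*^ey=x$, and $(x*^gy)*^hz=(x*^hz)*^{h^{-1}gh}(y*^hz)$. For $G=\mathbb Z$ or $\mathbb Z_n$, the group operation is addition. *)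

(* Defs.v *)
From HB Require Import structures.
From mathcomp Require Import all_boot all_order all_algebra boolp.

Set Implicit Arguments.
Unset Strict Implicit.
Unset Printing Implicit Defensive.

Import Order.TTheory GRing.Theory Num.Theory.
Local Open Scope ring_scope.

HB.mixin Record isRack (X : Type) := {
  rack_op : X -> X -> X;
  rack_inhabited : inhabited X;
  rack_bij : forall a : X, bijective (fun x => rack_op x a);
  rack_distr : forall x y z : X,
    rack_op (rack_op x y) z = rack_op (rack_op x z) (rack_op y z)
}.

#[short(type="rackType")]
HB.structure Definition Rack := {X of isRack X}.

Definition rack_S (X : rackType) (a x : X) : X := rack_op x a.

Lemma rack_S_inv_exists (X : rackType) (a : X) :
  exists g : X -> X, cancel (rack_S a) g /\ cancel g (rack_S a).
Proof. by have [g fK gK] := rack_bij a; exists g. Qed.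

Definition rack_S_inv (X : rackType) (a : X) : X -> X :=
  sval (cid (rack_S_inv_exists a)).

Lemma rack_SK (X : rackType) (a : X) : cancel (rack_S a) (rack_S_inv a).
Proof. by rewrite /rack_S_inv; case: cid => g []. Qed.

Lemma rack_S_invK (X : rackType) (a : X) : cancel (rack_S_inv a) (rack_S a).
Proof. by rewrite /rack_S_inv; case: cid => g []. Qed.

(* [rack_pow k x a] is x *^k a; recall that [Negz n] is the integer -(n + 1). *)
Definition rack_pow (X : rackType) (k : int) (x a : X) : X :=
  match k with
  | Posz n => iter n (rack_S a) x
  | Negz n => iter n.+1 (rack_S_inv a) x
  end.

Definition rack_period (X : rackType) : pred nat :=
  fun n => (0 < n)%N && `[< forall a b : X, rack_pow n%:Z a b = a >].

(* [None] stands for an infinite type. *)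
Definition rack_type (X : rackType) : option nat :=
  match pselect (exists n, rack_period X n) with
  | left ex => Some (ex_minn ex)
  | right _ => None
  end.

Lemma rack_type_SomeP (X : rackType) (n : nat) :
  rack_type X = Some n <->
  [/\ (0 < n)%N, forall a b : X, rack_pow n%:Z a b = a &
      forall m : nat, (0 < m)%N -> (forall a b : X, rack_pow m%:Z a b = a) ->
        (n <= m)%N].
Proof.
rewrite /rack_type; case: pselect => [ex|nex]; split => //.
- case: ex_minnP => m /andP[m0 /asboolP mP] mmin [<-]; split => // k k0 kP.
  by apply: mmin; rewrite /rack_period k0; apply/asboolP.
- case: ex_minnP => m /andP[m0 /asboolP mP] mmin [n0 nP nmin]; congr Some.
  apply/eqP; rewrite eqn_leq nmin // andbT.
  by apply: mmin; rewrite /rack_period n0; apply/asboolP.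
- move=> [n0 nP _]; case: nex; exists n.
  by rewrite /rack_period n0; apply/asboolP.
Qed.

Lemma rack_type_NoneP (X : rackType) :
  rack_type X = None <->
  ~ exists2 n : nat, (0 < n)%N & forall a b : X, rack_pow n%:Z a b = a.
Proof.
rewrite /rack_type; case: pselect => [ex|nex]; split => //.
- by case: ex => n /andP[n0 /asboolP nP] []; exists n.
- move=> _ [n n0 nP]; case: nex; exists n.
  by rewrite /rack_period n0; apply/asboolP.
Qed.

(* The group Z/(n+1)Z is ['I_n.+1] with its canonical addition modulo n + 1 (the
   notation ['Z_n] would be wrong for n = 1, and racks of type 1 exist).  The
   operation indexed by i uses the representative of i in {0, ..., n}; by
   [rack_pow_mod] any other one gives the same operation when n + 1 is the
   type of the rack. *)
Definition rack_pow_ord (X : rackType) (n : nat) (i : 'I_n.+1) : X -> X -> X :=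
  rack_pow (nat_of_ord i)%:Z.

Lemma rack_pow1D (X : rackType) (k : int) (x a : X) :
  rack_pow (k + 1) x a = rack_S a (rack_pow k x a).
Proof.
case: k => n; first by rewrite -PoszD addn1.
case: n => [|n]; first by rewrite /= rack_S_invK.
have -> : Negz n.+1 + 1 = Negz n by rewrite !NegzE -addn1 PoszD opprD subrK.
by rewrite [in RHS]/= rack_S_invK.
Qed.

Lemma rack_pow_addn (X : rackType) (k : int) (n : nat) (x a : X) :
  rack_pow (k + n%:Z) x a = rack_pow n%:Z (rack_pow k x a) a.
Proof.
elim: n => [|n IHn]; first by rewrite addr0.
by rewrite -addn1 PoszD addrA !rack_pow1D IHn.
Qed.

Lemma rack_pow_mod (X : rackType) (n : nat) (k m : int) (x a : X) :
  rack_type X = Some n -> (k = m %[mod n%:Z])%Z ->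
  rack_pow k x a = rack_pow m x a.
Proof.
move=> /rack_type_SomeP[n0 nP _] km.
have addM (q : nat) l : rack_pow (l + (q * n)%:Z) x a = rack_pow l x a.
  elim: q => [|q IHq]; first by rewrite mul0n addr0.
  by rewrite mulSn addnC PoszD addrA rack_pow_addn nP.
suff modE l : rack_pow l x a = rack_pow (l %% n%:Z)%Z x a.
  by rewrite modE km -modE.
rewrite {1}(divz_eq l n%:Z) addrC; case: (l %/ n%:Z)%Z => q.
  by rewrite -PoszM addM.
by rewrite -[LHS](addM q.+1) NegzE mulNr PoszM subrK.
Qed.

(* [op g x y] is x *^g y. *)
Definition is_rack_family (G : groupType) (X : Type) (op : G -> X -> X -> X) :
    Prop :=
  [/\ forall (g h : G) (x y : X), op (g * h)%g x y = op h (op g x y) y,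
      forall x y : X, op 1%g x y = x &
      forall (g h : G) (x y z : X),
        op h (op g x y) z = op (h^-1 * g * h)%g (op h x z) (op h y z)].

(* Main.v *)
Require Import Defs.
From mathcomp Require Import all_boot all_order all_algebra.

Import GRing.Theory.
Local Open Scope ring_scope.

(** The operations [rack_pow k] at a fixed [a] are the powers of one bijection, so exponents add
    ([rack_powD]). Self-distributivity says that each [rack_S a] is a rack automorphism; hence its
    integer powers respect every [rack_pow k] ([rack_pow_morph]). This is the third axiom, since
    conjugation is trivial in an abelian group. Modulo the type, [rack_pow_mod] makes the choice of
    representatives harmless. *)

Lemma rack_powD (X : rackType) (k m : int) (x a : X) :
  rack_pow (k + m) x a = rack_pow m (rack_pow k x a) a.
Proof.
case: m => n; first exact: rack_pow_addn.
have iterK (p : nat) : cancel (iter p (rack_S a)) (iter p (rack_S_inv a)).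
  by elim: p => // p IHp y; rewrite iterSr /= rack_SK IHp.
(* Splitting [k] as [(k - n.+1) + n.+1] on the right makes the inverse iterate undo a forward
   one. *)
rewrite -[in RHS](subrK n.+1%:Z k) rack_pow_addn -NegzE.
by rewrite [RHS]iterK.
Qed.

Lemma rack_S_morph (X : rackType) (k : int) (x y a : X) :
  rack_S a (rack_pow k x y) = rack_pow k (rack_S a x) (rack_S a y).
Proof.
have SM u : rack_S a (rack_S y u) = rack_S (rack_S a y) (rack_S a u).
  exact: rack_distr.
have SVM u : rack_S a (rack_S_inv y u) = rack_S_inv (rack_S a y) (rack_S a u).
  (* The inverse case follows by applying an injective translation to both sides. *)
  by apply: (can_inj (rack_SK (rack_S a y))); rewrite -SM !rack_S_invK.
case: k => n; rewrite /rack_pow; last move: n.+1 => {}n.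
- by elim: n => //= n IHn; rewrite SM IHn.
- by elim: n => //= n IHn; rewrite SVM IHn.
Qed.

Lemma rack_pow_morph (X : rackType) (k m : int) (x y a : X) :
  rack_pow m (rack_pow k x y) a = rack_pow k (rack_pow m x a) (rack_pow m y a).
Proof.
have SVM u v : rack_S_inv a (rack_pow k u v) =
    rack_pow k (rack_S_inv a u) (rack_S_inv a v).
  by apply: (can_inj (rack_SK a)); rewrite rack_S_morph !rack_S_invK.
case: m => n; first by elim: n => //= n ->; rewrite rack_S_morph.
rewrite [rack_pow (Negz n)]/rack_pow; move: n.+1 => {}n.
by elim: n => //= n ->; rewrite SVM.
Qed.

Theorem proposition3p6 (X : rackType) :
  is_rack_family (G := Algebra.to_multiplicative int) (@rack_pow X) /\
  (forall n : nat, rack_type X = Some n.+1 ->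
     is_rack_family (G := Algebra.to_multiplicative 'I_n.+1) (@rack_pow_ord X n)).
Proof.
have conj_abelian (V : zmodType) (g h : V) : - h + g + h = g.
  by rewrite addrAC addNr add0r.
split=> [|n typeX]; split=> [g h x y|x y|g h x y z] //.
- exact: rack_powD.
- by rewrite [(_ * _)%g]conj_abelian rack_pow_morph.
(* The sum in ['I_n.+1] is only congruent to the integer sum of representatives, which suffices as
   [n.+1] is the type. *)
- rewrite /rack_pow_ord -rack_powD; apply: (rack_pow_mod _ _ typeX).
  by rewrite -PoszD !modz_nat /= modn_mod.
- by rewrite [(_ * _)%g]conj_abelian /rack_pow_ord rack_pow_morph.
Qed.
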